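(* Let $X$ be a real Hilbert space, $g\in\Gamma_0(X)$, $h:X\to\mathbb{R}$ convex and differentiable with $L$-Lipschitz gradient, $L\in]0,+\infty[$, and $f=g+h$ with $\operatorname{argmin} f\neq\emptyset$. Let $\lambda\in]0,2L^{-1}[$, $x_0\in X$, and $x_{n+1}=\operatorname{prox}_{\lambda g}(x_n-\lambda\nabla h(x_n))$ for $n\in\mathbb{N}$. Assume that: (a) $(x_n)$ admits a subsequence converging strongly to some $\bar x\in X$; (b) for some $p\in[1,+\infty[$ there exist $\delta,r\in]0,+\infty]$ such that $f$ is $p$-Łojasiewicz, with constant $c$, on $\Omega:=\mathbb{B}_X(\bar x,\delta)\cap\{x\in X: f(x)<r+\inf f\}$. Then there exists $n_0\in\mathbb{N}$ such that the sequence $y_n:=x_{n_0+n}$ satisfies the following. With $r_n:=f(y_n)-\inf f$ and $\kappa:=\lambda(2-\lambda L)[2c^2]^{-1}$, $(y_n)$ converges strongly to some $x_\infty\in\operatorname{argmin} f$ and there exist constants $C_p,C_p'>0$ such that: (i) if $p=1$: $y_n=x_\infty$ for every $n\ge r_0/\kappa$; (ii) if $p\in]1,2[$: for all $n\in\mathbb{N}$, $r_{n+1}\le(r_n/\kappa)^{\frac{p}{2(p-1)}}$ and $\|y_{n+1}-x_\infty\|\le C_p r_n^{1/2}$; (iii) if $p=2$: for all $n\in\mathbb{N}$, $r_{n+1}\le\frac1{1+\kappa}r_n$ and $\|y_{n+1}-x_\infty\|\le C_2r_0^{1/2}(1+\kappa)^{-n/2}$; (iv) if $p>2$: for all $n\in\mathbb{N}$,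 $r_n\le(C_p')^{p/(p-2)}n^{-\frac p{p-2}}$ and $\|y_{n+1}-x_\infty\|\le C_p(C_p')^{1/(p-2)}n^{-\frac1{p-2}}$. When $0<r_0<+\infty$, the constants can be taken as: $C_p=2pc(2-\lambda L)^{-1}+(2\lambda r_0)^{1/2}(2-\lambda L)^{-1/2}r_0^{-1/p}$ if $p\ge2$; $C_p=2pc\,r_0^{1/p}(2-\lambda L)^{-1}r_0^{-1/2}+(2\lambda)^{1/2}(2-\lambda L)^{-1/2}$ if $p\le2$; and, for $p>2$, $$(C_p')^{-1}=\min\left\{\kappa,\kappa^{\frac{p-2}{2p-2}}\right\}\max_{s\ge1}\min\left\{\frac{p-2}{ps},\ \kappa^{\frac{2-p}{2p-2}}r_0^{\frac{2-p}{p}}\left(1-s^{-\frac{p-2}{2p-2}}\right)\right\}.$$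
   Context: $\Gamma_0(X)$ is the set of proper, convex, lower semicontinuous functions $X\to]-\infty,+\infty]$. $\operatorname{prox}_{\lambda g}(x)=\operatorname{argmin}_{u\in X}\{g(u)+\frac1{2\lambda}\|u-x\|^2\}$. $\mathbb{B}_X(\bar x,\delta)$ is the open ball (equal to $X$ if $\delta=+\infty$). $\operatorname{dom}^*f:=\operatorname{dom} f\setminus\operatorname{argmin} f$; $\|\partial f(x)\|_-:=\operatorname{dist}(0,\partial f(x))$, equal to $+\infty$ if $\partial f(x)=\emptyset$. For $p\in[1,+\infty[$, $f$ is $p$-Łojasiewicz on $\Omega$ with constant $c>0$ if $(f(x)-\inf f)^{1-1/p}\le c\,\|\partial f(x)\|_-$ for all $x\in\Omega\cap\operatorname{dom}^*f$. Right-hand sides are allowed to equal $+\infty$ (with $0^{-s}=+\infty$ for $s>0$). *)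

(* Defs.v *)
From HB Require Import structures.
From mathcomp Require Import all_boot all_order all_algebra.
From mathcomp Require Import all_classical all_reals all_analysis.

Set Implicit Arguments.
Unset Strict Implicit.
Unset Printing Implicit Defensive.

Import Order.TTheory GRing.Theory Num.Theory.
Import numFieldNormedType.Exports.

Local Open Scope classical_set_scope.
Local Open Scope ring_scope.

Section Defs.
Context {R : realType}.

(* A real Hilbert space is a complete normed module [X] together with a
   positive definite symmetric form inducing its norm. *)
Definition induces_norm (X : completeNormedModType R)
    (dot : {dot X for idfun}) : Prop :=
  forall x, `|x| ^+ 2 = dot x x.

Definition argmin (T : Type) (f : T -> \bar R) : set T :=
  [set x | forall y, (f x <= f y)%E].

Definition dom (T : Type) (f : T -> \bar R) : set T :=
  [set x | (f x < +oo)%E].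

Definition dom_star (T : Type) (f : T -> \bar R) : set T :=
  dom f `\` argmin f.

Definition einf (T : Type) (f : T -> \bar R) : \bar R := ereal_inf (range f).

Section Hilbert.
Context {X : completeNormedModType R}.
Implicit Types (f g : X -> \bar R) (h : X -> R) (dot : {dot X for idfun}).

Definition proper f : Prop :=
  (forall x, (-oo < f x)%E) /\ (exists x, (f x < +oo)%E).

Definition econvex f : Prop :=
  forall (x y : X) (t : R), 0 < t < 1 ->
    (f (t *: x + (1 - t) *: y)%R <= t%:E * f x + (1 - t)%R%:E * f y)%E.

Definition Gamma0 f : Prop :=
  [/\ proper f, econvex f & lower_semicontinuous f].

Definition is_gradient dot h (gradh : X -> X) : Prop :=
  forall x, differentiable (h : X -> R^o) x /\
    forall v, 'd (h : X -> R^o) x v = dot (gradh x) v.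

(* The proximal point is the unique element of this set when [g] is in
   [Gamma0] and [lam] is positive. *)
Definition prox (lam : R) g (x : X) : set X :=
  argmin (fun u => (g u + ((2 * lam)^-1 * `|u - x| ^+ 2)%R%:E)%E).

(* [delta] may be [+oo], in which case the ball is the whole space. *)
Definition eball (xbar : X) (delta : \bar R) : set X :=
  [set x | (`|x - xbar|%R%:E < delta)%E].

Definition subdiff dot f (x : X) : set X :=
  [set u | forall y, (f x + (dot u (y - x)%R)%:E <= f y)%E].

(* Distance from [0] to the subdifferential; [ereal_inf set0] is [+oo]. *)
Definition subdiff_dist0 dot f (x : X) : \bar R :=
  ereal_inf [set (`|u|%R)%:E | u in subdiff dot f x].

Definition lojasiewicz dot f (p c : R) (Omega : set X) : Prop :=
  forall x, (Omega `&` dom_star f) x ->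
    ((f x - einf f) `^ (1 - p^-1)%R <= c%:E * subdiff_dist0 dot f x)%E.

(* Real powers of extended reals are total: [+oo `^ s] is [+oo] for [s > 0].
   Since [0 `^ (- s)] is [0] in the library, negative powers of [n] are written
   as extended inverses, so that they are [+oo] at [n = 0]. *)
Definition rates (p kappa : R) (r : nat -> \bar R) (y : nat -> X) (xinf : X)
    (C C' : R) : Prop :=
  [/\ p = 1 -> forall n : nat,
        (r 0%N / kappa%:E <= n%:R%:E)%E -> y n = xinf,
      1 < p < 2 -> forall n : nat,
        (r n.+1 <= (r n / kappa%:E) `^ (p / (2 * (p - 1)))%R)%E /\
        (`|y n.+1 - xinf|%R%:E <= C%:E * r n `^ (2^-1)%R)%E,
      p = 2 -> forall n : nat,
        (r n.+1 <= (1 / (1 + kappa))%R%:E * r n)%E /\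
        (`|y n.+1 - xinf|%R%:E <=
           C%:E * r 0%N `^ (2^-1)%R * ((1 + kappa) `^ (- (n%:R / 2)))%R%:E)%E
    & 2 < p -> forall n : nat,
        (r n <= (C' `^ (p / (p - 2)))%R%:E *
                ((n%:R `^ (p / (p - 2)))%R%:E)^-1)%E /\
        (`|y n.+1 - xinf|%R%:E <=
           (C * C' `^ (1 / (p - 2)))%R%:E * ((n%:R `^ (1 / (p - 2)))%R%:E)^-1)%E].

End Hilbert.

Definition C_large (p c lam L r0 : R) : R :=
  2 * p * c * (2 - lam * L)^-1 +
  (2 * lam * r0) `^ (2^-1) * (2 - lam * L) `^ (- 2^-1) * r0 `^ (- p^-1).

Definition C_small (p c lam L r0 : R) : R :=
  2 * p * c * r0 `^ (p^-1) * (2 - lam * L)^-1 * r0 `^ (- 2^-1) +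
  (2 * lam) `^ (2^-1) * (2 - lam * L) `^ (- 2^-1).

Definition Cprime_objective (p kappa r0 s : R) : R :=
  Num.min ((p - 2) / (p * s))
    (kappa `^ ((2 - p) / (2 * p - 2)) * r0 `^ ((2 - p) / p) *
     (1 - s `^ (- ((p - 2) / (2 * p - 2))))).

Definition is_max (A : set R) (M : R) : Prop := A M /\ ubound A M.

Definition explicit_constants (p c lam L kappa r0 C C' : R) : Prop :=
  [/\ 2 <= p -> C = C_large p c lam L r0,
      p <= 2 -> C = C_small p c lam L r0
    & 2 < p -> exists2 M,
        is_max [set Cprime_objective p kappa r0 s | s in [set s | 1 <= s]] M
        & C'^-1 =
          Num.min kappa (kappa `^ ((p - 2) / (2 * p - 2))) * M].

End Defs.

(* Main.v *)
Require Import Defs.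
From HB Require Import structures.
From mathcomp Require Import all_boot all_order all_algebra.
From mathcomp Require Import all_classical all_reals all_analysis.
From mathcomp Require Import ring lra.

Set Implicit Arguments.
Unset Strict Implicit.
Unset Printing Implicit Defensive.

Import Order.TTheory GRing.Theory Num.Theory.
Import numFieldNormedType.Exports.

Local Open Scope classical_set_scope.
Local Open Scope ring_scope.

(** The forward-backward method is a descent method with two quantitative
    properties. With [a := (2 - lam * L) / (2 * lam)] and [b := lam^-1], a step
    from [x] to [u] satisfies [f u + a * |u - x| ^ 2 <= f x] ([step_decrease],
    by the descent lemma for [h]), and [f] has at [u] a subgradient of norm at
    most [b * |u - x|] ([step_subgradient_f], [step_subgradient_bound], because
    [id - lam * gradh] is nonexpansive for [lam < 2 / L]). The step is moreover
    Fejer monotone with respect to the minimizers ([step_fejer]).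

    Steps are therefore square summable, so the iterates carry subgradients that
    tend to [0]. Passing to the limit along the convergent subsequence shows
    that [xbar] is a minimizer and that the objective tends to its infimum, and
    Fejer monotonicity makes the whole sequence converge to [xbar]
    ([cluster_point_limit]). From some index on the iterates thus stay in the
    set on which the Lojasiewicz inequality is assumed. Combined with the two
    properties above it reads, for the gaps [r n] to the infimum and
    [kap := a / (c * b) ^ 2],
      [kap * r n.+1 ^ (2 - 2 / p) <= r n - r n.+1]
    ([values_recursion]). Everything about the values follows from this
    recursion: finite termination when [p = 1], a power rate when [p < 2], a
    linear rate when [p = 2]; when [p > 2], [r n ^ (- (p - 2) / p)] grows at
    least by a constant at each step ([values_inverse_increment]), which gives
    the sublinear rate.

    For the iterates, concavity of [t ^ (1 / p)] turns the same inequalities into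
      [d n.+1 <= d n / 2 +
         (p * c * b / (2 * a)) * (r n.+1 ^ (1 / p) - r n.+2 ^ (1 / p))]
    for the step lengths [d n] ([step_contraction]). Summing, the distance from
    [y n.+1] to the limit is at most
    [(r n / a) ^ (1 / 2) + (p * c * b / a) * r n.+1 ^ (1 / p)]
    ([distance_to_limit]). Of the two powers of [r n] the one with the smaller
    exponent dominates, up to a power of [r 0]: [1 / 2] when [p <= 2] and
    [1 / p] when [p >= 2]. This is where [C_small] and [C_large] come from. *)

(** * Smooth convex functions on a Hilbert space *)

(** Used to divide an inequality by [t] and let [t] tend to [0]. *)
Lemma le_of_le_add_small (R : realFieldType) (a b K : R) :
  (forall t, 0 < t < 1 -> a <= b + t * K) -> a <= b.
Proof.
move=> H; rewrite leNgt; apply/negP => ba.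
have K0 : 0 < `|K| + 1 by rewrite ltr_wpDl.
pose t := Num.min 2^-1 ((a - b) / (2 * (`|K| + 1))).
have t0 : 0 < t by rewrite lt_min invr_gt0 ltr0n divr_gt0 ?subr_gt0 ?mulr_gt0.
have t1 : t < 1 by rewrite gt_min; apply/orP; left; lra.
have tK : t * K <= (a - b) / 2.
  apply: (@le_trans _ _ (t * (`|K| + 1))).
    by rewrite ler_pM2l// ler_wpDr// ler_norm.
  apply: (@le_trans _ _ ((a - b) / (2 * (`|K| + 1)) * (`|K| + 1))).
    by rewrite ler_pM2r// ge_min lexx orbT.
  by rewrite invfM -!mulrA mulVf ?mulr1// gt_eqF.
have := H t; rewrite t0 t1 => /(_ isT); lra.
Qed.

Section Hilbert.
Context (R : realType) (X : completeNormedModType R).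
Context (dot : {dot X for idfun}) (hdot : induces_norm dot).
Implicit Types (x y z u v w : X) (a : R).

Lemma dotC x y : dot x y = dot y x.
Proof. by rewrite hermC expr0 mul1r. Qed.

Lemma dotDl x y z : dot (x + y) z = dot x z + dot y z.
Proof. exact: linearDl. Qed.

Lemma dotDr x y z : dot z (x + y) = dot z x + dot z y.
Proof. exact: linearDr. Qed.

Lemma dotNl x z : dot (- x) z = - dot x z.
Proof. exact: linearNl. Qed.

Lemma dotNr x z : dot z (- x) = - dot z x.
Proof. exact: linearNr. Qed.

Lemma dotZl a x z : dot (a *: x) z = a * dot x z.
Proof. exact: linearZl_LR. Qed.

Lemma dotZr a x z : dot z (a *: x) = a * dot z x.
Proof. by rewrite dotC dotZl dotC. Qed.

Definition dotE := (dotDl, dotDr, dotNl, dotNr, dotZl, dotZr).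

Lemma dot_le_norms x y : dot x y <= `|x| * `|y|.
Proof.
have [->|x0] := eqVneq x 0.
  by rewrite normr0 mul0r -(scale0r 0) dotZl mul0r.
have [->|y0] := eqVneq y 0.
  by rewrite normr0 mulr0 -(scale0r 0) dotZr mul0r.
have nx : 0 < `|x| by rewrite normr_gt0.
have ny : 0 < `|y| by rewrite normr_gt0.
have := sqr_ge0 `|(`|y| *: x - `|x| *: y)|.
rewrite hdot !dotE -!hdot (dotC y x) => H.
have {}H : 0 <= (`|x| * `|y|) * (2 * (`|x| * `|y| - dot x y)) by nra.
by move: H; rewrite pmulr_rge0 ?mulr_gt0// pmulr_rge0// subr_ge0.
Qed.

Lemma dot_geN_norms x y : - (`|x| * `|y|) <= dot x y.
Proof. by rewrite lerNl -dotNl -(normrN x) dot_le_norms. Qed.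

Section Smooth.
Context (h : X -> R) (gradh : X -> X) (L : R).
Hypothesis hgrad : is_gradient dot h gradh.

Lemma is_derive_along_line x d (t : R) :
  is_derive t (1 : R) (fun s : R => h (x + s *: d) : R^o)
    (dot (gradh (x + t *: d)) d).
Proof.
have [dh dhE] := hgrad (x + t *: d).
(* the difference quotients are those of h at x + t d in the direction d *)
have E : (fun u : R =>
      u^-1 *: ((h (x + (u *: (1 : R) + t) *: d) : R^o) - h (x + t *: d))) =
    (fun u : R => u^-1 *: ((h (u *: d + (x + t *: d)) : R^o) - h (x + t *: d))).
  apply/funext => u; congr (_ *: (h _ - _)).
  by rewrite [u *: 1]mulr1 scalerDl addrCA addrA addrC addrA.
split.
  by rewrite /derivable E; exact: diff_derivable.
by rewrite /derive E -dhE -deriveE.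
Qed.

Hypothesis hlip : L.-lipschitz gradh.

Lemma lipschitz_gradient x y : `|gradh x - gradh y| <= L * `|x - y|.
Proof. exact: (@hlip (x, y)). Qed.

Lemma descent_lemma x y :
  h y <= h x + dot (gradh x) (y - x) + L / 2 * `|y - x| ^+ 2.
Proof.
pose d := y - x.
(* the claim is psi 1 <= psi 0; the derivative of psi is nonpositive on [0, 1] *)
pose psi := fun s : R => (h (x + s *: d) -
  (s * dot (gradh x) d + s ^+ 2 * (L / 2 * `|d| ^+ 2))) : R^o.
pose dpsi := fun s : R => dot (gradh (x + s *: d)) d -
   (dot (gradh x) d + (2 * s) * (L / 2 * `|d| ^+ 2)).
have dpsiP s : is_derive s (1 : R) psi (dpsi s).
  have := is_derive_along_line x d s => ?.
  apply: is_deriveB.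
  apply: is_deriveD.
    apply: is_derive_eq.
    by rewrite !scaler0 add0r [LHS]mulr1.
  apply: is_derive_eq.
  rewrite !scaler0 add0r /GRing.scale /=; ring.
have cpsi : {within `[0, 1], continuous psi}.
  apply: derivable_within_continuous => s _.
  by case: (dpsiP s).
have [s] := @MVT_segment R psi dpsi 0 1 ler01 (fun s _ => dpsiP s) cpsi.
rewrite in_itv/= => /andP[s0 s1].
rewrite /psi /dpsi !scale1r !scale0r addr0 expr0n /= !mul0r expr1n !mul1r.
rewrite {1 2}/d addrCA subrr addr0 subr0 mulr1 => E.
have := dot_le_norms (gradh (x + s *: d) - gradh x) d.
have := lipschitz_gradient (x + s *: d) x.
rewrite addrAC subrr add0r normrZ (ger0_norm s0) dotDl dotNl => H1 H2.
have H3 : dot (gradh (x + s *: d)) d - dot (gradh x) d <= L * (s * `|d|) * `|d|.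
  by apply: (le_trans H2); rewrite ler_wpM2r.
nra.
Qed.

(** Only the order of the error term matters below, so the mean value theorem is
    applied to [h] itself and yields [L] instead of the sharp [L / 2]. *)
Lemma descent_lemmaN x y :
  h x + dot (gradh x) (y - x) - L * `|y - x| ^+ 2 <= h y.
Proof.
pose d := y - x.
have dP s := is_derive_along_line x d s.
have c : {within `[0, 1], continuous (fun s : R => h (x + s *: d) : R^o)}.
  by apply: derivable_within_continuous => s _; case: (dP s).
have [s] := MVT_segment ler01 (fun s _ => dP s) c.
rewrite in_itv/= => /andP[s0 s1].
rewrite !scale1r !scale0r addr0 subr0 mulr1 {1}/d addrCA subrr addr0 => E.
have := dot_geN_norms (gradh (x + s *: d) - gradh x) d.
have := lipschitz_gradient (x + s *: d) x.
rewrite addrAC subrr add0r normrZ (ger0_norm s0) dotDl dotNl => H1 H2.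
have H3 : - (L * (s * `|d|) * `|d|) <=
    dot (gradh (x + s *: d)) d - dot (gradh x) d.
  by apply: le_trans H2; rewrite lerN2 ler_wpM2r.
rewrite -/d.
have L0 : 0 <= L * `|d|.
  have := lipschitz_gradient y x; apply: le_trans; exact: normr_ge0.
have : 0 <= L * `|d| * ((1 - s) * `|d|).
  by rewrite mulr_ge0// mulr_ge0// subr_ge0.
nra.
Qed.

Hypothesis hconv : convex_function setT h.

Lemma convex_funE x y (t : R) : 0 <= t <= 1 ->
  h (t *: x + (1 - t) *: y) <= t * h x + (1 - t) * h y.
Proof.
move=> /andP[t0 t1].
have := @hconv (Itv01 t0 t1) x y; apply; exact: in_setT.
Qed.

(** Convexity bounds [h (x + t (y - x)) - h x] by [t (h y - h x)], and
    [descent_lemmaN] compares it with [t] times the inner product up to [O(t^2)]. *)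
Lemma gradient_inequality x y : h x + dot (gradh x) (y - x) <= h y.
Proof.
apply: (@le_of_le_add_small _ _ _ (L * `|y - x| ^+ 2)) => t /andP[t0 t1].
have := @convex_funE y x t; rewrite (ltW t0) (ltW t1) => /(_ isT) H1.
have := descent_lemmaN x (t *: y + (1 - t) *: x).
have -> : t *: y + (1 - t) *: x - x = t *: (y - x).
  by rewrite scalerBl scale1r scalerBr addrAC addrA subrK.
rewrite normrZ dotZr (gtr0_norm t0) => H2.
rewrite -(ler_pM2l t0); nra.
Qed.

Hypothesis hL : 0 < L.

(** The point [y + L^-1 (gradh x - gradh y)] is the one at which the gap between
    the affine minorant of [h] taken at [x] and its quadratic majorant taken at
    [y] is the most favourable. *)
Lemma gradient_inequality_strong x y :
  h x + dot (gradh x) (y - x) + (2 * L)^-1 * `|gradh x - gradh y| ^+ 2 <= h y.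
Proof.
have [e eE ->] : exists2 e, `|e| ^+ 2 = dot (gradh x) e - dot (gradh y) e &
    gradh x - gradh y = e.
  by exists (gradh x - gradh y); rewrite // hdot dotDl dotNl.
have := gradient_inequality x (y + L^-1 *: e).
have := descent_lemma y (y + L^-1 *: e).
have -> : y + L^-1 *: e - y = L^-1 *: e by rewrite addrAC subrr add0r.
rewrite normrZ gtr0_norm ?invr_gt0// exprMn => H1 H2.
have := le_trans H2 H1; rewrite eE !dotE invfM.
set A := dot (gradh x) e; set B := dot (gradh y) e.
have -> : L / 2 * (L^-1 ^+ 2 * (A - B)) = 2^-1 * L^-1 * (A - B).
  by field; rewrite gt_eqF.
lra.
Qed.

(** The Baillon-Haddad inequality, by adding [gradient_inequality_strong] to its
    symmetric version. *)
Lemma cocoercive x y :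
  L^-1 * `|gradh x - gradh y| ^+ 2 <= dot (gradh x - gradh y) (x - y).
Proof.
have := gradient_inequality_strong x y.
have := gradient_inequality_strong y x.
rewrite (distrC (gradh y)) !dotE invfM; lra.
Qed.

Lemma gradient_step_nonexpansive (lam : R) x y : 0 < lam < 2 * L^-1 ->
  `|(x - lam *: gradh x) - (y - lam *: gradh y)| <= `|x - y|.
Proof.
move=> /andP[l0 l1].
rewrite -(@ler_pXn2r _ 2) ?nnegrE//.
set e := gradh x - gradh y; set d := x - y.
have -> : (x - lam *: gradh x) - (y - lam *: gradh y) = d - lam *: e.
  by rewrite /e /d scalerBr !opprD !opprK addrACA.
have := cocoercive x y; rewrite -/e -/d => H.
clearbody d e; rewrite hdot !dotE -!hdot (dotC d e).
have : 0 <= lam * (2 * L^-1 - lam) * `|e| ^+ 2.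
  by rewrite mulr_ge0 ?exprn_ge0// mulr_ge0 ?subr_ge0 ?ltW.
have := ler_wpM2l (ltW l0) H; lra.
Qed.

End Smooth.
End Hilbert.

(** * Inequalities between real powers *)

Section PowerInequalities.
Context (R : realType).
Implicit Types (e s t v w : R).

Lemma le_powR e v w : 0 <= e -> 0 <= v -> v <= w -> v `^ e <= w `^ e.
Proof.
by move=> e0 v0 vw; rewrite ge0_ler_powR ?nnegrE// (le_trans v0).
Qed.

(** For [e <= 0] this is [expR u >= 1 + u] at [u = e * ln s] together with
    [ln s <= s - 1]; for [1 <= e] it is applied to the factor [s `^ (e - 1)] of
    [s `^ e], with [ln s >= 1 - s^-1]. *)
Lemma bernoulli_powR e s : 0 < s -> (e <= 0) || (1 <= e) ->
  1 + e * (s - 1) <= s `^ e.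
Proof.
move=> s0.
have ln_le t : 0 < t -> ln t <= t - 1.
  by move=> t0; rewrite -[in leLHS](subrKC 1 t) le_ln1Dx//; lra.
have exp_ge u : 1 + u * ln s <= s `^ u by rewrite /powR gt_eqF// expR_ge1Dx.
case/orP => e_range.
  by apply: le_trans (exp_ge e); rewrite lerD2l ler_wnM2l// ln_le.
rewrite -(mulr_powRB1 (ltW s0) (lt_le_trans ltr01 e_range)).
have ln_ge : 1 - s^-1 <= ln s.
  by have := ln_le s^-1; rewrite invr_gt0 lnV// => /(_ s0); lra.
apply: (@le_trans _ _ (s * (1 + (e - 1) * (1 - s^-1)))).
  by rewrite le_eqVlt; apply/orP; left; apply/eqP; field; rewrite gt_eqF.
rewrite ler_pM2l//; apply: le_trans (exp_ge (e - 1)).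
by rewrite lerD2l ler_wpM2l// subr_ge0.
Qed.

(** Bernoulli's inequality at [s = w / v], rescaled: a convex power lies above
    its tangents. *)
Lemma powR_tangent e v w : 0 < v -> 0 < w -> (e <= 0) || (1 <= e) ->
  v `^ e + e * v `^ (e - 1) * (w - v) <= w `^ e.
Proof.
move=> v0 w0 he.
have -> : w `^ e = v `^ e * (w / v) `^ e.
  by rewrite -powRM ?ltW ?divr_gt0// mulrCA divff ?mulr1// gt_eqF.
have := bernoulli_powR (divr_gt0 w0 v0) he.
rewrite -(ler_pM2l (powR_gt0 e v0)); apply: le_trans.
have -> : v `^ (e - 1) = v `^ e / v.
  by rewrite powRB ?(gt_eqF v0) ?implybT// powRr1// ltW.
by rewrite le_eqVlt; apply/orP; left; apply/eqP; field; rewrite gt_eqF.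
Qed.

Lemma powR_le_scale t t0 (a b : R) : 0 <= t -> t <= t0 -> 0 < a -> a <= b ->
  t `^ b <= t `^ a * t0 `^ (b - a).
Proof.
move=> t_ge0 tt0 a0 ab.
move: t_ge0; rewrite le_eqVlt => /predU1P[<-|t_gt0].
  by rewrite !powR0 ?mul0r// gt_eqF// (lt_le_trans a0).
rewrite -[in leLHS](subrKC a b) (@powRD _ t) ?(gt_eqF t_gt0) ?implybT//.
by rewrite ler_wpM2l ?powR_ge0// le_powR ?subr_ge0// ltW.
Qed.

End PowerInequalities.

(** * Descent sequences satisfying a Lojasiewicz inequality *)

Section LojasiewiczSequence.
Context (R : realType) (V : normedModType R).
Context (r : nat -> R) (y : nat -> V) (al b c p : R).
Hypotheses (al0 : 0 < al) (b0 : 0 < b) (c0 : 0 < c) (p1 : 1 <= p).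
Hypothesis r_ge0 : forall n, 0 <= r n.
Hypothesis decrease : forall n, r n.+1 + al * `|y n.+1 - y n| ^+ 2 <= r n.
Hypothesis lojas : forall n, 0 < r n.+1 ->
  r n.+1 `^ (1 - p^-1) <= c * (b * `|y n.+1 - y n|).

Let kap := al / (c * b) ^+ 2.
Let p0 : 0 < p. Proof. exact: lt_le_trans p1. Qed.
Let kap0 : 0 < kap. Proof. by rewrite divr_gt0 ?exprn_gt0 ?mulr_gt0. Qed.
Let al_ge0 := ltW al0.
Let b_ge0 := ltW b0.
Let c_ge0 := ltW c0.
Let p_ge0 := ltW p0.
Let kap_ge0 := ltW kap0.
Let slope_ge0 : 0 <= p * c * b / al.
Proof. by rewrite divr_ge0 ?mulr_ge0. Qed.
Let pV_ge0 : 0 <= p^-1. Proof. by rewrite invr_ge0. Qed.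

Lemma values_step n : r n.+1 <= r n.
Proof. by apply: le_trans (decrease n); rewrite lerDl mulr_ge0 ?exprn_ge0. Qed.

Lemma values_nonincreasing m n : (m <= n)%N -> r n <= r m.
Proof.
by apply: (@nonincreasing_seqP _ _ r).1; exact: values_step.
Qed.

(** The Lojasiewicz inequality bounds a power of the value by the last step, and
    the square of that step is paid for by the decrease. *)
Lemma values_recursion n : 0 < r n.+1 ->
  kap * (r n.+1 `^ (1 - p^-1)) ^+ 2 <= r n - r n.+1.
Proof.
move=> rn; apply: (@le_trans _ _ (kap * (c * (b * `|y n.+1 - y n|)) ^+ 2)).
  by rewrite ler_pM2l// lerXn2r ?nnegrE ?powR_ge0 ?mulr_ge0// lojas.
have := decrease n; rewrite lerBrDl; apply: le_trans.
by rewrite lerD2l mulrA exprMn mulrA divfK// expf_neq0// gt_eqF ?mulr_gt0.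
Qed.

Lemma values_finite_termination n : p = 1 -> r 0%N / kap <= n%:R -> r n = 0.
Proof.
move=> p1E; rewrite ler_pdivrMr// => rn; apply/eqP; rewrite eq_le r_ge0 andbT.
rewrite leNgt; apply/negP => rn0.
suff H : forall k, 0 < r k -> r k + k%:R * kap <= r 0%N.
  by have := H n rn0; rewrite leNgt ltr_pwDl.
elim=> [|k IH] rk; first by rewrite mul0r addr0.
have := IH (lt_le_trans rk (values_step k)).
have := values_recursion rk.
rewrite p1E invr1 subrr powRr0 expr1n mulr1 -natr1; lra.
Qed.

Lemma values_power_rate n : 1 < p ->
  r n.+1 <= (r n / kap) `^ (p / (2 * (p - 1))).
Proof.
move=> p_gt1.
have := r_ge0 n.+1; rewrite le_eqVlt => /predU1P[<-|rn]; first exact: powR_ge0.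
have := values_recursion rn => H.
have {}H : r n.+1 `^ ((1 - p^-1) * 2) <= r n / kap.
  rewrite ler_pdivlMr// mulrC powRrM powR_mulrn ?powR_ge0//.
  by apply: (le_trans H); rewrite gerBl ltW.
have q0 : 0 < p / (2 * (p - 1)).
  by rewrite divr_gt0// mulr_gt0// subr_gt0.
have -> : r n.+1 = (r n.+1 `^ ((1 - p^-1) * 2)) `^ (p / (2 * (p - 1))).
  rewrite -powRrM (_ : _ * _ = 1) ?powRr1 ?ltW//.
  by field; rewrite !gt_eqF ?subr_gt0.
by rewrite le_powR ?powR_ge0// ltW.
Qed.

Lemma values_linear_rate n : p = 2 -> r n.+1 <= (1 + kap)^-1 * r n.
Proof.
move=> p2; have k1 : 0 < 1 + kap by rewrite addr_gt0.
have := r_ge0 n.+1; rewrite le_eqVlt => /predU1P[<-|rn].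
  by rewrite mulr_ge0 ?r_ge0// invr_ge0 ltW.
have := values_recursion rn; rewrite p2.
have -> : 1 - 2^-1 = 2^-1 :> R by field.
rewrite powR12_sqrt ?r_ge0// sqr_sqrtr ?r_ge0// => H.
by rewrite -ler_pdivrMl ?invr_gt0// invrK; lra.
Qed.

Lemma values_geometric n : p = 2 -> r n <= (1 + kap) ^- n * r 0%N.
Proof.
move=> p2; have k1 : 0 < 1 + kap by rewrite addr_gt0.
elim: n => [|n IH]; first by rewrite expr0 invr1 mul1r.
apply: (le_trans (values_linear_rate n p2)).
by rewrite exprS invfM -mulrA ler_pM2l ?invr_gt0.
Qed.

(** Write [be := (p - 2) / p], so that the recursion has exponent [be + 1]. If
    [r n ^ (be + 1) <= s * r n.+1 ^ (be + 1)], convexity of [t ^ (- be)] and the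
    recursion give the first bound. Otherwise [r] has dropped by so large a factor
    that [r n.+1 ^ (- be)] exceeds [r n ^ (- be)] by a factor [s ^ q] with
    [q := be / (be + 1)], whatever the recursion says; this is the second bound. *)
Lemma values_inverse_increment n (s : R) : 2 < p -> 1 <= s -> 0 < r n.+1 ->
  r n `^ (- ((p - 2) / p)) +
    Num.min (kap * ((p - 2) / (p * s)))
       (r 0%N `^ (- ((p - 2) / p)) * (1 - s `^ (- ((p - 2) / (2 * p - 2)))))
  <= r n.+1 `^ (- ((p - 2) / p)).
Proof.
move=> p2 s1 rn1.
have s0 : 0 < s by exact: lt_le_trans s1.
have rn : 0 < r n by exact: lt_le_trans (values_step n).
set q := (p - 2) / (2 * p - 2).
have -> : (p - 2) / (p * s) = (p - 2) / p / s by rewrite invfM mulrA.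
have eE : (1 - p^-1) * 2 = (p - 2) / p + 1 by field; rewrite gt_eqF.
have qE : ((p - 2) / p + 1) * q = (p - 2) / p.
  by rewrite /q; field; apply/andP; split; rewrite gt_eqF//; lra.
have be0 : 0 < (p - 2) / p by rewrite divr_gt0// subr_gt0.
have q0 : 0 < q by rewrite divr_gt0//; lra.
move: ((p - 2) / p) q eE qE be0 q0 => be q eE qE be0 q0.
have := values_recursion rn1.
rewrite -powR_mulrn ?powR_ge0// -powRrM eE => H.
have [le_s|lt_s] := lerP (r n `^ (be + 1)) (s * r n.+1 `^ (be + 1)).
  have tangent := @powR_tangent _ (- be) _ _ rn rn1.
  have {tangent} := tangent _; rewrite oppr_le0 (ltW be0) => /(_ isT).
  apply: le_trans; rewrite lerD2l.
  rewrite ge_min; apply/orP; left.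
  rewrite -opprD powRN -mulrA mulNr -mulrN -mulrN opprB mulrCA ler_pM2l//.
  rewrite [leRHS]mulrC ler_pdivlMr ?powR_gt0//.
  apply: le_trans H.
  by rewrite -mulrA ler_pM2l// ler_pdivrMl.
have {}lt_s : s `^ q * r n.+1 `^ be <= r n `^ be.
  rewrite -qE powRrM [X in _ <= X]powRrM -powRM ?powR_ge0 ?(ltW s0)//.
  by rewrite le_powR ?(ltW q0) ?(ltW lt_s)// mulr_ge0 ?powR_ge0// ltW.
have u1 : 1 <= s `^ q.
  by have := le_powR (ltW q0) ler01 s1; rewrite powR1.
rewrite !powRN.
have u0 : 0 < s `^ q by rewrite powR_gt0.
have a0 : 0 < r n `^ be by rewrite powR_gt0.
have b1 : 0 < r n.+1 `^ be by rewrite powR_gt0.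
have H1 : s `^ q * (r n `^ be)^-1 <= (r n.+1 `^ be)^-1.
  by rewrite ler_pdivrMr// ler_pdivlMl// mulrC.
apply: le_trans H1.
apply: (@le_trans _ _ ((r n `^ be)^-1 + (r n `^ be)^-1 * (s `^ q - 1))).
  2: lra.
rewrite lerD2l ge_min; apply/orP; right.
apply: ler_pM => //.
- by rewrite invr_ge0 powR_ge0.
- by rewrite subr_ge0 invf_le1.
- rewrite lef_pV2 ?posrE ?powR_gt0 ?(lt_le_trans rn) ?values_nonincreasing//.
  by rewrite le_powR ?r_ge0 ?values_nonincreasing ?(ltW be0).
have : 0 <= (s `^ q - 1) * (1 - (s `^ q)^-1).
  by rewrite mulr_ge0 ?subr_ge0 ?invf_le1.
by rewrite mulrBr mulr1 mulrBl mul1r divff ?(gt_eqF u0)//; lra.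
Qed.

Lemma values_sublinear_rate n (C s : R) :
  2 < p -> 1 <= s -> 0 < C -> (0 < n)%N ->
  C^-1 <= kap * ((p - 2) / (p * s)) ->
  C^-1 <= r 0%N `^ (- ((p - 2) / p)) * (1 - s `^ (- ((p - 2) / (2 * p - 2)))) ->
  r n <= C `^ (p / (p - 2)) * (n%:R `^ (p / (p - 2)))^-1.
Proof.
move=> p2 s1 C0 n0 HC1 HC2.
have := r_ge0 n; rewrite le_eqVlt => /predU1P[<-|rn0].
  by rewrite mulr_ge0 ?invr_ge0 ?powR_ge0.
have H : forall k, 0 < r k -> k%:R * C^-1 <= r k `^ (- ((p - 2) / p)).
  elim=> [|k IH] rk; first by rewrite mul0r powR_ge0.
  apply: le_trans (values_inverse_increment p2 s1 rk).
  rewrite -natr1 mulrDl mul1r lerD ?IH ?(lt_le_trans rk) ?values_step//.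
  by rewrite le_min HC1 HC2.
have := H n rn0.
have be0 : 0 < (p - 2) / p by rewrite divr_gt0// subr_gt0.
have iE : p / (p - 2) = ((p - 2) / p)^-1 by rewrite invf_div.
rewrite iE; move: ((p - 2) / p) be0 => be be0 {}H.
have nC : 0 < n%:R / C by rewrite divr_gt0// ltr0n.
have -> : C `^ be^-1 * (n%:R `^ be^-1)^-1 = (C / n%:R) `^ be^-1.
  rewrite powRM ?invr_ge0 ?(ltW C0)//.
  by rewrite -(powR_inv1 (ler0n _ n)) -powRrM mulN1r powRN.
have -> : r n = (r n `^ be) `^ be^-1.
  by rewrite -powRrM divff ?gt_eqF// powRr1.
rewrite le_powR ?powR_ge0 ?invr_ge0 ?(ltW be0)//.
move: H; rewrite powRN -[n%:R / C]invrK lef_pV2 ?posrE ?powR_gt0 ?invr_gt0//.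
by rewrite invf_div.
Qed.

(** With [t0, t1] the values at [n.+1, n.+2], concavity of [t ^ (1 / p)] gives
    [t0 - t1 <= p * (t0 ^ (1 / p) - t1 ^ (1 / p)) * t0 ^ (1 - 1 / p)]. The left-hand
    side dominates a multiple of the square of the new step, the last factor is
    dominated by a multiple of the old step, so the new step is at most
    the geometric mean of the old step and a multiple of the drop of
    [r ^ (1 / p)], hence at most their arithmetic mean. *)
Lemma step_contraction n :
  `|y n.+2 - y n.+1| <= 2^-1 * `|y n.+1 - y n| +
    p * c * b / al * (r n.+1 `^ p^-1 - r n.+2 `^ p^-1) / 2.
Proof.
have Dge0 : 0 <= r n.+1 `^ p^-1 - r n.+2 `^ p^-1.
  by rewrite subr_ge0 le_powR ?r_ge0 ?values_step.
have dec := decrease n.+1.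
have := r_ge0 n.+1; rewrite le_eqVlt => /predU1P[r1|r1].
  have d0 : `|y n.+2 - y n.+1| ^+ 2 <= 0.
    by rewrite -(pmulr_rle0 _ al0); have := r_ge0 n.+2; lra.
  have -> : `|y n.+2 - y n.+1| = 0.
    by apply/eqP; rewrite -sqrf_eq0 eq_le d0 sqr_ge0.
  by rewrite addr_ge0 ?mulr_ge0 ?invr_ge0.
(* the tangent inequality for the power p, at the p-th roots of the values *)
have key : r n.+1 - r n.+2 <=
    p * (r n.+1 `^ p^-1 - r n.+2 `^ p^-1) * r n.+1 `^ (1 - p^-1).
  have := r_ge0 n.+2; rewrite le_eqVlt => /predU1P[<-|r2].
    rewrite powR0 ?gt_eqF ?invr_gt0// !subr0 -mulrA.
    rewrite -powRD ?(gt_eqF r1) ?implybT//.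
    by rewrite subrKC powRr1 ?r_ge0// ler_peMl ?r_ge0.
  have := @powR_tangent _ p (r n.+1 `^ p^-1) (r n.+2 `^ p^-1)
    (powR_gt0 _ r1) (powR_gt0 _ r2).
  rewrite p1 orbT => /(_ isT).
  rewrite -!powRrM mulVf ?gt_eqF// !powRr1 ?r_ge0//.
  have -> : p^-1 * (p - 1) = 1 - p^-1 by field; rewrite gt_eqF.
  lra.
have lo := lojas r1.
set D := _ - _ in Dge0 key *.
set d1 := `|y n.+2 - y n.+1| in dec *.
set d0 := `|y n.+1 - y n| in lo *.
have d1_ge0 : 0 <= d1 by exact: normr_ge0.
have d0_ge0 : 0 <= d0 by exact: normr_ge0.
have sq : d1 ^+ 2 <= d0 * (p * c * b / al * D).
  rewrite -(ler_pM2l al0).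
  have -> : al * (d0 * (p * c * b / al * D)) = p * D * (c * (b * d0)).
    by field; rewrite gt_eqF.
  apply: (@le_trans _ _ (r n.+1 - r n.+2)); first lra.
  by apply: (le_trans key); rewrite ler_wpM2l// mulr_ge0.
have G0 : 0 <= p * c * b / al * D by rewrite mulr_ge0.
move: (p * c * b / al * D) sq G0 => G sq G0.
rewrite -(@ler_pXn2r _ 2) ?nnegrE//; last by lra.
apply: (le_trans sq).
have := sqr_ge0 (d0 - G); nra.
Qed.

(** The last step is kept on the left-hand side so that the factor [1 / 2] of
    [step_contraction] is absorbed and the induction goes through. *)
Lemma path_length n k :
  `|y (n.+1 + k)%N - y n.+1| + `|y (n + k).+1 - y (n + k)%N| <=
  `|y n.+1 - y n| + p * c * b / al * (r n.+1 `^ p^-1 - r (n + k).+1 `^ p^-1).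
Proof.
elim: k => [|k IH]; first by rewrite !addn0 !subrr normr0 mulr0 add0r addr0.
rewrite !addnS !addSn in IH *.
have := ler_distD (y (n + k).+1) (y (n + k).+2) (y n.+1).
have := step_contraction (n + k).
lra.
Qed.

Lemma distance_to_limit (z : V) n : y @ \oo --> z ->
  `|y n.+1 - z| <=
  al `^ (- 2^-1) * r n `^ 2^-1 + p * c * b / al * r n.+1 `^ p^-1.
Proof.
move=> yz.
have dn : `|y n.+1 - y n| <= al `^ (- 2^-1) * r n `^ 2^-1.
  have H : `|y n.+1 - y n| ^+ 2 <= al^-1 * r n.
    rewrite mulrC ler_pdivlMr// mulrC.
    by have := decrease n; have := r_ge0 n.+1; lra.
  have -> : `|y n.+1 - y n| = (`|y n.+1 - y n| ^+ 2) `^ 2^-1.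
    by rewrite powR12_sqrt ?exprn_ge0// sqrtr_sqr normr_id.
  rewrite -mulN1r powRrM -powRM ?powR_ge0 ?r_ge0// powR_inv1//.
  by rewrite le_powR ?exprn_ge0 ?invr_ge0.
apply/ler_addgt0Pr => e e0.
have /cvgrPdist_lt/(_ e e0)[N _ HN] := yz.
have := path_length n N.
have /ltW := HN (n.+1 + N)%N (leq_addl _ _).
have := ler_distD (y (n.+1 + N)%N) (y n.+1) z.
rewrite (distrC z) (distrC (y n.+1) (y _)).
have : 0 <= p * c * b / al * r (n + N).+1 `^ p^-1.
  by rewrite mulr_ge0 ?powR_ge0.
have : 0 <= `|y (n + N).+1 - y (n + N)%N| by [].
lra.
Qed.

End LojasiewiczSequence.

(** * The maximum defining the constant of the sublinear rate *)

Section MaxMin.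
Context (R : realType).

(** The first function decreases from [A] to [0] and the second one increases
    from [0] to [K], so the maximum of their minimum is attained where they cross. *)
Lemma max_min_crossing (A K q : R) : 0 < A -> 0 < K -> 0 < q ->
  exists s, [/\ 1 <= s, A / s = K * (1 - s `^ (- q)) &
    forall t, 1 <= t -> Num.min (A / t) (K * (1 - t `^ (- q))) <= A / s].
Proof.
move=> A0 K0 q0.
(* at S the first function is at most K / 2 and the second one at least K / 2 *)
pose S := Num.max (2 `^ q^-1) (Num.max (2 * A / K) 1).
have S1 : 1 <= S by rewrite /S !le_max lexx !orbT.
have S0 : 0 < S by rewrite (lt_le_trans ltr01).
pose F s : R := K * (1 - s `^ (- q)) - A * s `^ (-1).
have Fc : {within `[1, S], continuous F}.
  apply: continuous_in_subspaceT => s; rewrite inE/= in_itv/= => /andP[s1 _].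
  have cpow e : {for s, continuous (@powR R ^~ e)}.
    apply/differentiable_continuous/derivable1_diffP/derivable_powR.
    by rewrite in_itv/= andbT (lt_le_trans ltr01).
  apply: cvgB; (apply: cvgM; first exact: cvg_cst); last exact: cpow.
  by apply: cvgB; [exact: cvg_cst | exact: cpow].
have F1 : F 1 <= 0 by rewrite /F !powR1; nra.
have FS : 0 <= F S.
  have H1 : S `^ (- q) <= 2^-1.
    rewrite powRN lef_pV2 ?posrE ?powR_gt0//.
    have <- : (2 `^ q^-1) `^ q = 2 :> R.
      by rewrite -powRrM mulVf ?gt_eqF// powRr1.
    by rewrite le_powR ?powR_ge0 ?(ltW q0)// le_max lexx.
  have H2 : A * S `^ (-1) <= K * 2^-1.
    have : 2 * A / K <= S by rewrite /S !le_max lexx orbT.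
    rewrite ler_pdivrMr// powR_inv1 ?(ltW S0)// ler_pdivrMr//; lra.
  rewrite /F; nra.
have [|s] := @IVT R F 1 S 0 S1 Fc; first by rewrite ge_min le_max F1 FS orbT.
rewrite in_itv/= => /andP[s1 _] Fs.
have s0 : 0 < s by rewrite (lt_le_trans ltr01).
have E : A / s = K * (1 - s `^ (- q)).
  by move: Fs; rewrite /F powR_inv1 ?(ltW s0)//; lra.
exists s; split=> // t t1; have t0 : 0 < t by rewrite (lt_le_trans ltr01).
rewrite ge_min; have [st|/ltW ts] := lerP s t; apply/orP; [left|right].
  by rewrite ler_pM2l// lef_pV2.
rewrite E ler_pM2l// lerD2l lerN2 !powRN lef_pV2 ?posrE ?powR_gt0//.
by rewrite le_powR ?(ltW q0)// ltW.
Qed.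

End MaxMin.

(** * Rates of convergence with explicit constants *)

Section Rates.
Context (R : realType) (X : completeNormedModType R).
Context (r : nat -> R) (y : nat -> X) (z : X) (lam L c p : R).
Hypotheses (lam0 : 0 < lam) (lamL : 0 < 2 - lam * L) (c0 : 0 < c) (p1 : 1 <= p).

Let al := (2 - lam * L) / (2 * lam).
Hypothesis r_ge0 : forall n, 0 <= r n.
Hypothesis decrease : forall n, r n.+1 + al * `|y n.+1 - y n| ^+ 2 <= r n.
Hypothesis lojas : forall n, 0 < r n.+1 ->
  r n.+1 `^ (1 - p^-1) <= c * (lam^-1 * `|y n.+1 - y n|).
Hypothesis yz : y @ \oo --> z.

Let kap := lam * (2 - lam * L) * (2 * c ^+ 2)^-1.

Let al0 : 0 < al. Proof. by rewrite divr_gt0// mulr_gt0. Qed.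
Let p0 : 0 < p. Proof. exact: lt_le_trans p1. Qed.
Let b0 : 0 < lam^-1. Proof. by rewrite invr_gt0. Qed.
Let kap0 : 0 < kap.
Proof. by rewrite mulr_gt0 ?mulr_gt0// invr_gt0 mulr_gt0 ?exprn_gt0. Qed.

Let kapE : al / (c * lam^-1) ^+ 2 = kap.
Proof. by rewrite /al /kap; field; rewrite !gt_eqF. Qed.

Let rS n : r n.+1 <= r n.
Proof. exact: values_step al0 decrease n. Qed.

Let r_le_r0 n : r n <= r 0%N.
Proof. exact: (values_nonincreasing al0 decrease). Qed.

Lemma iterate_distance n :
  `|y n.+1 - z| <=
   (2 * lam) `^ 2^-1 * (2 - lam * L) `^ (- 2^-1) * r n `^ 2^-1 +
   2 * p * c * (2 - lam * L)^-1 * r n.+1 `^ p^-1.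
Proof.
have := distance_to_limit al0 b0 c0 p1 r_ge0 decrease lojas n yz.
have -> : p * c / lam / al = 2 * p * c * (2 - lam * L)^-1.
  by rewrite /al; field; rewrite !gt_eqF.
suff -> : al `^ (- 2^-1) = (2 * lam) `^ 2^-1 * (2 - lam * L) `^ (- 2^-1) by [].
rewrite [RHS]mulrC /al (@powRM _ _ (2 * lam)^-1).
- congr (_ * _); rewrite -(@powR_inv1 _ (2 * lam)) ?mulr_ge0 ?(ltW lam0)//.
  by rewrite -powRrM mulN1r opprK.
- exact: ltW.
- by rewrite invr_ge0 mulr_ge0 ?(ltW lam0).
Qed.

Lemma limit_reached n : r n = 0 -> y n = z.
Proof.
move=> rn; have rn1 : r n.+1 = 0.
  by apply/eqP; rewrite eq_le r_ge0 andbT -rn rS.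
have := iterate_distance n; rewrite rn rn1 !powR0 ?gt_eqF ?invr_gt0//.
rewrite !mulr0 addr0 normr_le0 subr_eq0 => /eqP <-.
have := decrease n; rewrite rn rn1 add0r pmulr_rle0// => H.
apply/esym/eqP; rewrite -subr_eq0 -normr_eq0 -sqrf_eq0.
by rewrite eq_le H exprn_ge0.
Qed.

Lemma rates_at_minimum : r 0%N = 0 -> rates p kap (fun n => (r n)%:E) y z 1 1.
Proof.
move=> r00.
have rE n : r n = 0 by apply/eqP; rewrite eq_le r_ge0 andbT -r00 r_le_r0.
have yE n : `|y n - z| = 0 by rewrite limit_reached// subrr normr0.
split=> [_ n _|_ n|_ n|_ n].
- exact: limit_reached.
- rewrite !rE yE; split; first exact: poweR_ge0.
  by rewrite mule_ge0// poweR_ge0.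
- rewrite !rE yE; split; first by rewrite mule0.
  by rewrite !mule_ge0// ?poweR_ge0// lee_fin powR_ge0.
- by rewrite !rE yE; split; rewrite mule_ge0// ?inve_ge0 ?lee_fin ?powR_ge0.
Qed.

Lemma iterate_distance_large n : 0 < r 0%N -> 2 <= p ->
  `|y n.+1 - z| <= C_large p c lam L (r 0%N) * r n `^ p^-1.
Proof.
move=> r0 p2; apply: (le_trans (iterate_distance n)).
rewrite /C_large [leLHS]addrC (mulrDl _ _ (r n `^ _)) lerD//.
  rewrite ler_wpM2l ?le_powR ?r_ge0 ?invr_ge0 ?(ltW p0)//.
  by rewrite mulr_ge0 ?invr_ge0 ?(ltW lamL)// !mulr_ge0 ?(ltW p0) ?(ltW c0).
have := @powR_le_scale _ (r n) (r 0%N) p^-1 2^-1 (r_ge0 n) (r_le_r0 n).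
rewrite invr_gt0 p0 lef_pV2 ?posrE// => /(_ isT p2) H.
rewrite (@powRM _ (2 * lam) (r 0%N)) ?mulr_ge0 ?(ltW lam0)//.
have -> : forall a b d e f : R, a * b * d * e * f = a * d * (f * (b * e)).
  by move=> *; ring.
rewrite ler_wpM2l ?mulr_ge0 ?powR_ge0//; apply: (le_trans H).
by rewrite powRB ?(gt_eqF r0) ?implybT// -powRN.
Qed.

Lemma iterate_distance_small n : 0 < r 0%N -> p <= 2 ->
  `|y n.+1 - z| <= C_small p c lam L (r 0%N) * r n `^ 2^-1.
Proof.
move=> r0 p2; apply: (le_trans (iterate_distance n)).
rewrite /C_small [leLHS]addrC (mulrDl _ _ (r n `^ _)) lerD//.
have := @powR_le_scale _ (r n) (r 0%N) 2^-1 p^-1 (r_ge0 n) (r_le_r0 n).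
rewrite invr_gt0 lef_pV2 ?posrE// ltr0n => /(_ isT p2) H.
have -> : forall a b d e f g : R,
    a * b * d * e * f * g = a * b * e * (g * (d * f)).
  by move=> *; ring.
rewrite ler_wpM2l//.
  by rewrite mulr_ge0 ?invr_ge0 ?(ltW lamL)// !mulr_ge0 ?(ltW p0) ?(ltW c0).
apply: (@le_trans _ _ (r n `^ p^-1)).
  by rewrite le_powR ?r_ge0 ?invr_ge0 ?(ltW p0).
by apply: (le_trans H); rewrite powRB ?(gt_eqF r0) ?implybT// -powRN.
Qed.

Lemma C_large_small : 0 < r 0%N -> p = 2 ->
  C_large p c lam L (r 0%N) = C_small p c lam L (r 0%N).
Proof.
move=> r0 p2; rewrite /C_large /C_small p2.
rewrite (@powRM _ (2 * lam) (r 0%N)) ?mulr_ge0 ?(ltW lam0) ?(ltW r0)//.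
have : r 0%N `^ 2^-1 * r 0%N `^ (- 2^-1) = 1.
  by rewrite powRN divff// gt_eqF// powR_gt0.
move: (r 0%N `^ _) (r 0%N `^ _) => v u uv.
move: ((2 * lam) `^ _) ((2 - lam * L) `^ _) (2 - lam * L)^-1 => A B k.
have -> : A * u * B * v = A * B * (u * v) by ring.
have -> : 2 * 2 * c * u * k * v = 2 * 2 * c * k * (u * v) by ring.
by rewrite uv !mulr1.
Qed.

Lemma C_large_gt0 : 0 < r 0%N -> 0 < C_large p c lam L (r 0%N).
Proof.
move=> r0; rewrite addr_gt0// !mulr_gt0 ?powR_gt0 ?mulr_gt0//.
all: by rewrite ?invr_gt0 ?powR_gt0.
Qed.

Lemma C_small_gt0 : 0 < r 0%N -> 0 < C_small p c lam L (r 0%N).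
Proof.
move=> r0; rewrite addr_gt0// !mulr_gt0 ?powR_gt0 ?mulr_gt0//.
all: by rewrite ?invr_gt0 ?powR_gt0.
Qed.

(** [values_sublinear_rate] holds for every [s >= 1]; the constant is the one for
    the maximizing [s]. There the two entries of the minimum coincide, and
    [Num.min kap (kap `^ q)] is at most the factor [kap], resp. [kap `^ q], by
    which each of them differs from the corresponding increment. *)
Lemma sublinear_constant : 0 < r 0%N -> 2 < p ->
  exists C' : R, [/\ 0 < C',
    exists2 M, is_max [set Cprime_objective p kap (r 0%N) s
                      | s in [set s | 1 <= s]] M
      & C'^-1 = Num.min kap (kap `^ ((p - 2) / (2 * p - 2))) * M &
    forall n, (0 < n)%N ->
      r n <= C' `^ (p / (p - 2)) * (n%:R `^ (p / (p - 2)))^-1].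
Proof.
move=> r0 p2.
set q := (p - 2) / (2 * p - 2).
have q0 : 0 < q by rewrite divr_gt0//; lra.
have qN : (2 - p) / (2 * p - 2) = - q by rewrite -mulNr opprB.
have bN : (2 - p) / p = - ((p - 2) / p) by rewrite -mulNr opprB.
have [s [s1 sE sM]] := @max_min_crossing R ((p - 2) / p)
  (kap `^ (- q) * r 0%N `^ (- ((p - 2) / p))) q
  (divr_gt0 (ltac:(lra) : 0 < p - 2) p0)
  (mulr_gt0 (powR_gt0 _ kap0) (powR_gt0 _ r0)) q0.
have AE t : (p - 2) / (p * t) = (p - 2) / p / t by rewrite invfM mulrA.
have s0 : 0 < s by rewrite (lt_le_trans ltr01).
pose M := (p - 2) / p / s.
have M0 : 0 < M by rewrite !divr_gt0// subr_gt0.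
have m0 : 0 < Num.min kap (kap `^ q) by rewrite lt_min kap0 powR_gt0.
exists (Num.min kap (kap `^ q) * M)^-1; split.
- by rewrite invr_gt0 mulr_gt0.
- exists M; last by rewrite invrK.
  split.
    by exists s => //; rewrite /Cprime_objective AE qN bN -sE minxx.
  by move=> _ [t t1 <-]; rewrite /Cprime_objective AE qN bN; exact: sM.
- move=> n n0.
  apply: (@values_sublinear_rate _ _ r y al lam^-1 c p) s1 _ n0 _ _ => //.
  + by rewrite invr_gt0 mulr_gt0.
  + by rewrite invrK kapE AE ler_pM2r// ge_min lexx.
  + rewrite invrK -/q; apply: (@le_trans _ _ (kap `^ q * M)).
      by rewrite ler_pM2r// ge_min lexx orbT.
    by rewrite /M sE !mulrA powRN divff ?mul1r// gt_eqF// powR_gt0.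
Qed.

Lemma lojasiewicz_rates : exists C C' : R,
  [/\ 0 < C, 0 < C', rates p kap (fun n => (r n)%:E) y z C C'
    & 0 < r 0%N -> explicit_constants p c lam L kap (r 0%N) C C'].
Proof.
have := r_ge0 0%N; rewrite le_eqVlt => /predU1P[/esym r00|r0].
  by exists 1, 1; split=> //; [exact: rates_at_minimum | rewrite r00 ltxx].
have kapn0 : kap != 0 by rewrite gt_eqF.
have rates1 : p = 1 -> forall n : nat,
    ((r 0%N)%:E / kap%:E <= n%:R%:E)%E -> y n = z.
  move=> pE n; rewrite inver (negPf kapn0) lee_fin => H; apply: limit_reached.
  apply: (values_finite_termination (y := y) (al := al) (b := lam^-1)
    (c := c) (p := p)) => //.
  by rewrite kapE.
have rates2 n : 1 < p ->
    ((r n.+1)%:E <= ((r n)%:E / kap%:E) `^ (p / (2 * (p - 1)))%R)%E.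
  move=> p_gt1; rewrite inver (negPf kapn0) -EFinM poweR_EFin lee_fin -kapE.
  exact: (values_power_rate (y := y) (al := al) (b := lam^-1)
    (c := c) (p := p)).
have [p2|p2] := lerP p 2; last first.
  have [C' [C'0 C'E rC']] := sublinear_constant r0 p2.
  exists (C_large p c lam L (r 0%N)), C'.
  split; rewrite ?C_large_gt0//; last first.
    by move=> _; split=> // ?; exfalso; lra.
  split=> //; [by move=> /andP[_ ?]; exfalso; lra|by move=> ?; exfalso; lra|].
  move=> _ n; case: n => [|n].
    (* at n = 0 both right-hand sides are infinite *)
    rewrite !mulr0n !powR0 ?gt_eqF ?divr_gt0 ?subr_gt0//.
    rewrite inve0 !gt0_muley ?leey// lte_fin.
    - by rewrite mulr_gt0 ?C_large_gt0 ?powR_gt0.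
    - by rewrite powR_gt0.
  have n1 a : n.+1%:R `^ a != 0 :> R by rewrite gt_eqF// powR_gt0.
  rewrite !inver !(negPf (n1 _)) -!EFinM !lee_fin rC'//; split=> //.
  apply: (le_trans (iterate_distance_large n.+1 r0 (ltW p2))).
  rewrite -mulrA ler_pM2l ?C_large_gt0//.
  apply: (le_trans (le_powR _ (r_ge0 _) (rC' n.+1 isT))).
    by rewrite invr_ge0 ltW.
  have -> : 1 / (p - 2) = p / (p - 2) * p^-1.
    by field; rewrite !gt_eqF ?subr_gt0.
  rewrite !(powRrM _ _ p^-1) -!powRN.
  by rewrite powRM ?powR_ge0// -!powRrM mulNr mulrN.
exists (C_small p c lam L (r 0%N)), 1.
split; rewrite ?C_small_gt0//; last first.
  move=> _; split=> // [p2'|]; last by move=> ?; exfalso; lra.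
  by rewrite C_large_small//; apply/eqP; rewrite eq_le p2.
split=> //.
- move=> /andP[p_gt1 _] n; split; first exact: rates2.
  by rewrite poweR_EFin -EFinM lee_fin iterate_distance_small.
- move=> p2E n; split.
    rewrite -EFinM lee_fin div1r -kapE.
    exact: (values_linear_rate (y := y) (al := al) (b := lam^-1)
      (c := c) (p := p)).
  rewrite poweR_EFin -!EFinM lee_fin.
  apply: (le_trans (iterate_distance_small n r0 p2)).
  rewrite -mulrA ler_pM2l ?C_small_gt0//.
  have k1 : 0 <= 1 + kap by rewrite addr_ge0// ltW.
  have -> : (1 + kap) `^ (- (n%:R / 2)) = ((1 + kap) ^- n) `^ 2^-1.
    by rewrite -powR_invn// -powRrM mulNr.
  rewrite -powRM ?r_ge0 ?invr_ge0 ?exprn_ge0// mulrC.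
  rewrite le_powR ?r_ge0 ?invr_ge0// -kapE.
  exact: (values_geometric (y := y) (al := al) (b := lam^-1) (c := c) (p := p)).
- by move=> ?; exfalso; lra.
Qed.

End Rates.

(** * Subgradients and minimizers *)

Section Subgradients.
Context (R : realType) (X : completeNormedModType R).
Context (dot : {dot X for idfun}) (hdot : induces_norm dot).
Implicit Types (f g : X -> \bar R) (x y z u : X).

(** Fermat's rule for a sum: compare the value at [z] with the one at
    [z + t (y - z)], use convexity of [g] and the expansion of [q], divide by [t]
    and let [t] tend to [0]. A quadratic upper bound on [q] along segments is all
    the smoothness this takes; it covers both the squared distance of the proximal
    step and the function [h]. *)
Lemma argmin_sum_subgradient g (q : X -> R) a z :
  (forall x, (-oo < g x)%E) -> (g z < +oo)%E -> econvex g ->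
  (forall y, exists K, forall t : R, 0 < t < 1 ->
    q (t *: y + (1 - t) *: z) <= q z + t * dot a (y - z) + t * (t * K)) ->
  argmin (fun u => (g u + (q u)%:E)%E) z -> subdiff dot g z (- a).
Proof.
move=> gN gz gconv qub zmin y /=.
have [->|gy] := eqVneq (g y) +oo%E; first exact: leey.
have [K HK] := qub y.
have gzE : g z \is a fin_num by rewrite fin_real// gN gz.
have gyE : g y \is a fin_num by rewrite fin_real// gN ltey.
rewrite -(fineK gzE) -(fineK gyE) -EFinD lee_fin.
apply: (@le_of_le_add_small _ _ _ K) => t t01; have /andP[t0 t1] := t01.
have := zmin (t *: y + (1 - t) *: z) => /= H1.
have := le_trans H1 (leeD2r _ (gconv y z t t01)).
rewrite -(fineK gzE) -(fineK gyE) -!EFinM -!EFinD lee_fin => H2.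
have := HK t t01; rewrite dotNl => H3.
rewrite -(ler_pM2l t0); lra.
Qed.

Lemma prox_lty (lam : R) g x u :
  Defs.proper g -> prox lam g x u -> (g u < +oo)%E.
Proof.
move=> [gN [v gv]] umin.
have : (g u + ((2 * lam)^-1 * `|u - x| ^+ 2)%:E < +oo)%E.
  by apply: le_lt_trans (umin v) _; rewrite lte_add_pinfty// ltry.
by case: (g u) => [s||] /=; rewrite ?ltry.
Qed.

Lemma prox_subgradient (lam : R) g x u :
  0 < lam -> Defs.proper g -> econvex g ->
  prox lam g x u -> subdiff dot g u (lam^-1 *: (x - u)).
Proof.
move=> lam0 gproper gconv umin; have [gN _] := gproper.
rewrite -[x - u]opprB scalerN.
apply: (@argmin_sum_subgradient g
  (fun w => (2 * lam)^-1 * `|w - x| ^+ 2)) => //.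
  exact: (prox_lty gproper umin).
move=> y; exists ((2 * lam)^-1 * `|y - u| ^+ 2) => t /andP[t0 t1].
have -> : t *: y + (1 - t) *: u - x = (u - x) + t *: (y - u).
  by rewrite scalerBl scale1r scalerBr addrCA addrAC.
move: (u - x) (y - u) => b d.
rewrite (hdot (b + _)) !dotE -!hdot (dotC dot d b) invfM.
rewrite le_eqVlt; apply/orP; left; apply/eqP; field; rewrite gt_eqF//.
Qed.

Lemma gradient_at_minimizer g (h : X -> R) gradh (L : R) z :
  is_gradient dot h gradh -> L.-lipschitz gradh ->
  (forall x, (-oo < g x)%E) -> (g z < +oo)%E -> econvex g ->
  argmin (fun u => (g u + (h u)%:E)%E) z -> subdiff dot g z (- gradh z).
Proof.
move=> hgrad hlip gN gz gconv zmin.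
apply: (@argmin_sum_subgradient g h) => // y.
exists (L / 2 * `|y - z| ^+ 2) => t /andP[t0 t1].
have := descent_lemma hdot hgrad hlip z (t *: y + (1 - t) *: z).
have -> : t *: y + (1 - t) *: z - z = t *: (y - z).
  by rewrite scalerBl scale1r scalerBr addrAC addrA subrK.
by rewrite dotZr normrZ (gtr0_norm t0); lra.
Qed.

Lemma vanishing_subgradient_values f (w u : nat -> X) (xbar y : X) (b e : R) :
  w @ \oo --> xbar -> u @ \oo --> (0 : X) ->
  (forall n, subdiff dot f (w n) (u n)) -> f y = b%:E -> 0 < e ->
  \forall n \near \oo, (f (w n) <= (b + e)%:E)%E.
Proof.
move=> wx u0 wu fy e0.
have : `|u n| * `|y - w n| @[n --> \oo] --> (0 : R).
  rewrite -(mul0r `|y - xbar|) -(@normr0 _ X).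
  apply: cvgM; first exact: cvg_norm.
  by apply: cvg_norm; apply: cvgB wx; exact: cvg_cst.
move=> /cvgr_lt /(_ e e0); apply: filterS => n un.
have := wu n y; rewrite fy.
case: (f (w n)) => [s|//|_]; last exact: leNye.
rewrite -EFinD !lee_fin => H.
have := dot_geN_norms hdot (u n) (y - w n); lra.
Qed.

Lemma vanishing_subgradient_argmin f (w u : nat -> X) (xbar : X) :
  (forall x, (-oo < f x)%E) -> lower_semicontinuous f ->
  w @ \oo --> xbar -> u @ \oo --> (0 : X) ->
  (forall n, subdiff dot f (w n) (u n)) -> argmin f xbar.
Proof.
move=> fN flsc wx u0 wu y; rewrite leNgt; apply/negP => fyx.
have fyE : f y \is a fin_num by rewrite fin_real// fN (lt_le_trans fyx) ?leey.
have [a /andP[ya ax]] : exists a : R, (fine (f y) < a) && (a%:E < f xbar)%E.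
  move: fyx; rewrite -{1}(fineK fyE); case: (f xbar) => [s||//].
    rewrite lte_fin => ys; exists ((fine (f y) + s) / 2).
    by rewrite lte_fin; lra.
  by move=> _; exists (fine (f y) + 1); rewrite ltry; lra.
have [V Vx fV] := flsc _ _ ax.
have e0 : 0 < a - fine (f y) by rewrite subr_gt0.
have ev := vanishing_subgradient_values wx u0 wu (esym (fineK fyE)) e0.
have [n [Hn1 Hn2]] := filter_ex (filterI ev (wx _ Vx)).
by have := lt_le_trans (fV _ Hn2) Hn1; rewrite subrKC ltxx.
Qed.

Lemma lsc_add_continuous g (h : X -> R) :
  (forall x, (-oo < g x)%E) -> lower_semicontinuous g ->
  (forall x, {for x, continuous (h : X -> R^o)}) ->
  lower_semicontinuous (fun x => (g x + (h x)%:E)%E).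
Proof.
move=> gN glsc hc x a axh.
have [e e0 He] : exists2 e : R, 0 < e & ((a - h x + e)%:E < g x)%E.
  move: axh (gN x); case: (g x) => [s||//].
    rewrite -EFinD lte_fin => H _.
    by exists ((s + h x - a) / 2); rewrite ?lte_fin; lra.
  by move=> _ _; exists 1; rewrite ?ltry.
have [V Vx gV] := glsc _ _ He.
exists (V `&` [set y | h x - e < h y]).
  apply: filterI => //.
  apply: (@cvgr_gt _ _ _ _ (h : X -> R^o) (h x) (hc x)).
  by rewrite ltrBlDr ltrDl.
move=> y [Vy /= hy]; have := gV y Vy.
case: (g y) => [s|_|]; last by rewrite ltNge leNye.
  by rewrite -EFinD !lte_fin; lra.
by rewrite addye// ltry.
Qed.

End Subgradients.

Lemma summable_steps_vanish (R : realType) (r d : nat -> R) (al : R) :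
  0 < al -> (forall n, 0 <= r n) -> (forall n, 0 <= d n) ->
  (forall n, r n.+1 + al * d n ^+ 2 <= r n) -> d @ \oo --> (0 : R).
Proof.
move=> al0 r0 d0 dec.
have rcvg : cvgn r.
  apply: nonincreasing_is_cvgn.
    apply/nonincreasing_seqP => n; apply: le_trans (dec n).
    by rewrite lerDl mulr_ge0 ?exprn_ge0 ?(ltW al0).
  by exists 0 => _ [n _ <-].
have diff0 : r n - r n.+1 @[n --> \oo] --> (0 : R).
  rewrite -(subrr (limn r)); apply: cvgB => //.
  by rewrite (cvg_shiftS r).
apply/cvgr0Pnorm_lt => e e0.
have : 0 < al * e ^+ 2 by rewrite mulr_gt0 ?exprn_gt0.
move=> /(cvgr_lt _ diff0); apply: filterS => n /= H.
rewrite ger0_norm// -(@ltr_pXn2r _ 2) ?nnegrE ?(ltW e0)//.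
by rewrite -(ltr_pM2l al0); have := dec n; lra.
Qed.

Lemma einf_argmin (R : realType) (T : Type) (f : T -> \bar R) z :
  argmin f z -> einf f = f z.
Proof.
move=> zmin; apply/eqP; rewrite eq_le; apply/andP; split.
  by apply: ereal_inf_lbound; exists z.
by apply: le_ereal_inf_tmp => _ [y _ <-].
Qed.

(** * The forward-backward iteration *)

Section ForwardBackward.
Context (R : realType) (X : completeNormedModType R).
Context (dot : {dot X for idfun}) (hdot : induces_norm dot).
Context (g : X -> \bar R) (hg : Gamma0 g).
Context (h : X -> R) (gradh : X -> X) (L : R).
Hypotheses (hconv : convex_function setT h) (hgrad : is_gradient dot h gradh).
Hypotheses (hL : 0 < L) (hlip : L.-lipschitz gradh).
Context (f : X -> \bar R) (hf : forall z, f z = (g z + (h z)%:E)%E).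
Context (lam : R) (hlam : 0 < lam < 2 * L^-1).

Let lam0 : 0 < lam. Proof. by case/andP: hlam. Qed.
Let gN x : (-oo < g x)%E. Proof. by case: hg => -[]. Qed.
Let gconv : econvex g. Proof. by case: hg. Qed.

Lemma relaxation_gt0 : 0 < 2 - lam * L.
Proof. by rewrite subr_gt0 -ltr_pdivlMr//; case/andP: hlam. Qed.

Lemma objective_gtNy z : (-oo < f z)%E.
Proof. by rewrite hf; have := gN z; rewrite !ltNye; case: (g z). Qed.

Lemma objective_lty z : (f z < +oo)%E = (g z < +oo)%E.
Proof.
by rewrite hf; case: (g z) => [s||]; rewrite -?EFinD ?ltry ?addye ?addNye.
Qed.

Lemma argmin_finite z : argmin f z -> (g z < +oo)%E.
Proof.
move=> zmin; case: hg => -[_ [v gv] _ _].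
by rewrite -objective_lty (le_lt_trans (zmin v))// objective_lty.
Qed.

Lemma objective_lsc : lower_semicontinuous f.
Proof.
have -> : f = (fun x => (g x + (h x)%:E)%E) by apply/funext.
apply: lsc_add_continuous => //; first by case: hg.
by move=> x; have [dh _] := hgrad x; exact: differentiable_continuous.
Qed.

Section Step.
Context (x u : X) (xu : prox lam g (x - lam *: gradh x) u).

Lemma step_finite : (g u < +oo)%E.
Proof. by case: hg => gproper _ _; exact: prox_lty xu. Qed.

Lemma step_subgradient_g :
  subdiff dot g u (lam^-1 *: (x - lam *: gradh x - u)).
Proof. by apply: prox_subgradient => //; case: hg. Qed.

Lemma step_decrease :
  (f u + ((2 - lam * L) / (2 * lam) * `|u - x| ^+ 2)%:E <= f x)%E.
Proof.
have H1 := step_subgradient_g x.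
have H2 := descent_lemma hdot hgrad hlip x u.
set v := lam^-1 *: _ in H1.
have vE : dot v (x - u) = lam^-1 * `|u - x| ^+ 2 + dot (gradh x) (u - x).
  rewrite /v dotZl addrAC dotDl dotNl dotZl -hdot (distrC x) mulrBr.
  rewrite mulKf ?gt_eqF//.
  by rewrite -[u - x]opprB dotNr.
rewrite !hf; apply: le_trans (leeD H1 (lexx (h x)%:E)).
rewrite -!addeA -!EFinD leeD2l// lee_fin vE.
have -> : (2 - lam * L) / (2 * lam) = lam^-1 - L / 2 by field; rewrite gt_eqF.
lra.
Qed.

Lemma step_subgradient_f :
  subdiff dot f u
    (lam^-1 *: ((x - lam *: gradh x) - (u - lam *: gradh u))).
Proof.
move=> y; have H1 := step_subgradient_g y.
have H2 := gradient_inequality hdot hgrad hlip hconv u y.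
have -> : lam^-1 *: ((x - lam *: gradh x) - (u - lam *: gradh u)) =
    lam^-1 *: (x - lam *: gradh x - u) + gradh u.
  rewrite opprB (addrCA _ (lam *: _)) addrC scalerDr scalerA.
  by rewrite mulVf ?gt_eqF// scale1r.
rewrite dotDl !hf; move: H2; rewrite -lee_fin => /(leeD H1); apply: le_trans.
rewrite -!addeA -!EFinD leeD2l// lee_fin; lra.
Qed.

Lemma step_subgradient_bound :
  `|lam^-1 *: ((x - lam *: gradh x) - (u - lam *: gradh u))| <=
  lam^-1 * `|u - x|.
Proof.
rewrite normrZ gtr0_norm ?invr_gt0// ler_pM2l ?invr_gt0// (distrC u).
exact: (gradient_step_nonexpansive hdot hgrad hlip hconv hL).
Qed.

(** A minimizer [z] is a fixed point of the step. Monotonicity of the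
    subdifferential of [g] between [u] and [z] bounds [|u - z| ^ 2] by the inner
    product of [u - z] with the difference of the gradient steps from [x] and
    [z], and gradient steps are nonexpansive. *)
Lemma step_fejer z : argmin f z -> `|u - z| <= `|x - z|.
Proof.
move=> zmin; have gz := argmin_finite zmin.
have Hz : subdiff dot g z (- gradh z).
  apply: (gradient_at_minimizer hdot hgrad hlip) => //.
  by move=> y /=; rewrite -!hf; exact: zmin.
have guE : g u \is a fin_num by rewrite fin_real// gN step_finite.
have gzE : g z \is a fin_num by rewrite fin_real// gN gz.
have := Hz u; have := step_subgradient_g z.
rewrite -(fineK guE) -(fineK gzE) -!EFinD !lee_fin => H1 H2.
have := gradient_step_nonexpansive hdot hgrad hlip hconv hL x z hlam.
set Tx := x - lam *: gradh x in H1 *; set Tz := z - lam *: gradh z => Hne.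
have key : `|u - z| ^+ 2 <= dot (Tx - Tz) (u - z).
  have {}H1 : dot (Tx - u) (z - u) <= lam * (fine (g z) - fine (g u)).
    by rewrite -ler_pdivrMl// -dotZl; lra.
  have {}H2 : lam * (fine (g z) - fine (g u)) <= dot (lam *: gradh z) (u - z).
    by rewrite dotZl ler_pM2l//; move: H2; rewrite dotNl; lra.
  have := le_trans H1 H2.
  rewrite hdot /Tz; clearbody Tx; rewrite !dotE; lra.
have [->|uz] := eqVneq (u - z) 0; first by rewrite normr0.
rewrite -(@ler_pM2r _ `|u - z|) ?normr_gt0// -expr2.
apply: (le_trans key); apply: (le_trans (dot_le_norms hdot _ _)).
by rewrite ler_wpM2r.
Qed.

End Step.

Section Iterates.
Context (x : nat -> X).
Hypothesis xS : forall n, prox lam g (x n - lam *: gradh (x n)) (x n.+1).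
Hypothesis hargmin : argmin f !=set0.

(** Meaningful for [n > 0] only: the objective may be infinite at [x 0]. *)
Definition gap n := fine (f (x n)) - fine (einf f).

Lemma einf_fin : einf f = (fine (einf f))%:E.
Proof.
have [z zmin] := hargmin.
rewrite fineK// (einf_argmin zmin) fin_real// objective_gtNy objective_lty.
exact: argmin_finite.
Qed.

Lemma objective_iterate n : f (x n.+1) = (gap n.+1 + fine (einf f))%:E.
Proof.
rewrite /gap subrK fineK// fin_real// objective_gtNy objective_lty.
exact: step_finite (xS n).
Qed.

Lemma gap_ge0 n : 0 <= gap n.+1.
Proof.
have : (einf f <= f (x n.+1))%E by apply: ereal_inf_lbound; exists (x n.+1).
by rewrite objective_iterate einf_fin lee_fin lerDr.
Qed.

Lemma gap_decrease n :
  gap n.+2 + (2 - lam * L) / (2 * lam) * `|x n.+2 - x n.+1| ^+ 2 <= gap n.+1.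
Proof.
have := step_decrease (xS n.+1).
by rewrite !objective_iterate -EFinD lee_fin; lra.
Qed.

Let decrease_gt0 : 0 < (2 - lam * L) / (2 * lam).
Proof. by rewrite divr_gt0 ?mulr_gt0 ?relaxation_gt0. Qed.

Lemma gap_nonincreasing m n : (m <= n)%N -> gap n.+1 <= gap m.+1.
Proof.
exact: (@values_nonincreasing _ _ (gap \o S) (x \o S) _
  decrease_gt0 gap_decrease).
Qed.

Lemma steps_vanish : `|x n.+1 - x n| @[n --> \oo] --> (0 : R).
Proof.
rewrite -(cvg_shiftS (fun n => `|x n.+1 - x n|)).
exact: (@summable_steps_vanish _ (gap \o S) _ _ decrease_gt0 gap_ge0
  (fun=> normr_ge0 _) gap_decrease).
Qed.

Lemma distance_nonincreasing z m n :
  argmin f z -> (m <= n)%N -> `|x n - z| <= `|x m - z|.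
Proof.
move=> zmin; apply: (@nonincreasing_seqP _ _ (fun n => `|x n - z|)).1 => k.
exact: step_fejer (xS k) _ zmin.
Qed.

(** The successors of the iterates of the subsequence also converge to [xbar],
    since steps vanish, and they carry subgradients of [f] that vanish too.
    Hence [xbar] is a minimizer and the objective comes arbitrarily close to its
    infimum; Fejer monotonicity then turns the cluster point into a limit. *)
Lemma cluster_point_limit (phi : nat -> nat) (xbar : X) :
  {homo phi : m n / (m < n)%N} -> (x \o phi) @ \oo --> xbar ->
  [/\ argmin f xbar, x @ \oo --> xbar
    & forall e : R, 0 < e -> exists n, gap n.+1 < e].
Proof.
move=> phi_mono xphi.
have phi_ge n : (n <= phi n)%N.
  by elim: n => // n IH; exact: leq_ltn_trans IH (phi_mono _ _ (ltnSn n)).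
have phi_cvg : phi @ \oo --> \oo.
  move=> A [N _ HN]; exists N => // n Nn; apply: HN.
  exact: leq_trans Nn (phi_ge n).
have steps_phi : `|x (phi n).+1 - x (phi n)| @[n --> \oo] --> (0 : R).
  exact: (cvg_comp _ _ phi_cvg steps_vanish).
pose w n := x (phi n).+1.
have wx : w @ \oo --> xbar.
  have -> : w = (fun n => (x (phi n).+1 - x (phi n)) + x (phi n)).
    by apply/funext => n; rewrite subrK.
  by rewrite -[xbar]add0r; apply: cvgD => //; exact/norm_cvg0P.
pose u n := lam^-1 *: ((x (phi n) - lam *: gradh (x (phi n))) -
   (w n - lam *: gradh (w n))).
have u0 : u @ \oo --> (0 : X).
  apply/norm_cvg0P.
  apply: (@squeeze_cvgr _ _ _ _ (cst 0)
      (fun n => lam^-1 * `|x (phi n).+1 - x (phi n)|)).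
  - by near=> n; rewrite normr_ge0 /=; exact: step_subgradient_bound.
  - exact: cvg_cst.
  - by rewrite -(mulr0 lam^-1); apply: cvgM => //; exact: cvg_cst.
have wu n : subdiff dot f (w n) (u n) by exact: step_subgradient_f.
have xbar_min : argmin f xbar.
  exact: (vanishing_subgradient_argmin hdot objective_gtNy
    objective_lsc wx u0 wu).
split=> //.
  apply/cvgrPdist_lt => e e0.
  have /cvgrPdist_lt /(_ e e0)[N _ HN] := xphi.
  exists (phi N) => // n /= Nn; rewrite distrC.
  by rewrite (le_lt_trans (distance_nonincreasing xbar_min Nn))// distrC HN/=.
move=> e e0; have e2 : 0 < e / 2 by rewrite divr_gt0.
have xbarE : f xbar = (fine (einf f))%:E.
  by rewrite -einf_fin (einf_argmin xbar_min).
have := vanishing_subgradient_values hdot wx u0 wu xbarE e2.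
move=> /filter_ex[n]; rewrite objective_iterate lee_fin => H.
by exists (phi n); lra.
Unshelve. all: by end_near.
Qed.

Lemma gap_lojasiewicz (p c : R) (Omega : set X) n :
  0 < c -> lojasiewicz dot f p c Omega -> Omega (x n.+2) -> 0 < gap n.+2 ->
  gap n.+2 `^ (1 - p^-1) <= c * (lam^-1 * `|x n.+2 - x n.+1|).
Proof.
move=> c0 hloj xO gap0.
have xd : dom_star f (x n.+2).
  split; first by rewrite /dom /= objective_iterate ltry.
  move=> xmin; have := einf_argmin xmin.
  by rewrite objective_iterate {1}einf_fin => -[]; lra.
have := hloj _ (conj xO xd).
rewrite objective_iterate einf_fin -EFinB addrK poweR_EFin => H.
rewrite -lee_fin; apply: (le_trans H); rewrite EFinM; apply: lee_wpmul2l.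
  by rewrite lee_fin ltW.
have bound := step_subgradient_bound (x n.+1) (x n.+2).
apply: le_trans (_ : (_ <= _%:E)%E) (bound : (_%:E <= _%:E)%E).
apply: ereal_inf_lbound; eexists; last by [].
exact: step_subgradient_f (xS n.+1).
Qed.

End Iterates.

End ForwardBackward.

Unset Implicit Arguments.

(** * Convergence rates of the forward-backward method *)

Theorem corollary4p12 (R : realType) (X : completeNormedModType R)
    (dot : {dot X for idfun}) (hdot : induces_norm dot)
    (g : X -> \bar R) (hg : Gamma0 g)
    (h : X -> R) (gradh : X -> X) (L : R)
    (hconv : convex_function setT h)
    (hgrad : is_gradient dot h gradh)
    (hL : 0 < L) (hlip : L.-lipschitz gradh)
    (f : X -> \bar R) (hf : forall z, f z = (g z + (h z)%:E)%E)
    (hargmin : argmin f !=set0)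
    (lam : R) (hlam : 0 < lam < 2 * L^-1)
    (x : nat -> X)
    (hx : forall n, prox lam g (x n - lam *: gradh (x n)) (x n.+1))
    (xbar : X)
    (ha : exists2 phi : nat -> nat,
        {homo phi : m n / (m < n)%N} & (x \o phi) @ \oo --> xbar)
    (p : R) (hp : 1 <= p)
    (delta r : \bar R) (hdelta : (0 < delta)%E) (hr : (0 < r)%E)
    (c : R) (hc : 0 < c)
    (hloj : lojasiewicz dot f p c
        (eball xbar delta `&` [set z | (f z < r + einf f)%E])) :
  exists n0 : nat,
    let y := fun n => x (n0 + n)%N in
    let rs := fun n => (f (y n) - einf f)%E in
    let kappa := lam * (2 - lam * L) * (2 * c ^+ 2)^-1 in
    exists xinf : X,
      [/\ argmin f xinf,
          y @ \oo --> xinf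
        & exists C C' : R,
            [/\ 0 < C, 0 < C',
                rates p kappa rs y xinf C C'
              & (0 < rs 0%N < +oo)%E ->
                explicit_constants p c lam L kappa (fine (rs 0%N)) C C']].
Proof.
have lam0 : 0 < lam by case/andP: hlam.
have [phi phi_mono xphi] := ha.
have [xbar_min x_cvg small_gap] := cluster_point_limit hdot hg hconv hgrad hL
  hlip hf hlam hx hargmin phi_mono xphi.
have small_real (s : \bar R) :
    (0 < s)%E -> exists2 e : R, 0 < e & (e%:E <= s)%E.
  by case: s => [s||//] s0; [exists s | exists 1; rewrite ?leey].
have [e1 e1_gt0 e1r] := small_real _ hr.
have [e2 e2_gt0 e2delta] := small_real _ hdelta.
have [n1 Hn1] := small_gap _ e1_gt0.
have /cvgrPdist_lt /(_ e2 e2_gt0)[n2 _ Hn2] := x_cvg.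
(* from n1 on the gap is below r, and from n2 on the iterates are in the ball;
   the successor guarantees that the first value is finite *)
exists (maxn n1 n2).+1 => y rs kappa; exists xbar.
pose rr n := gap f x (maxn n1 n2 + n).+1.
have rsE : rs = (fun n => (rr n)%:E).
  apply/funext => n; rewrite /rs /y addSn (objective_iterate hg hf hx).
  by rewrite {2}(einf_fin hg hf hargmin) -EFinB addrK.
have y_cvg : y @ \oo --> xbar.
  apply: (cvg_comp (fun n => ((maxn n1 n2).+1 + n)%N) x _ x_cvg).
  move=> A [N _ HN]; exists N => // n Nn; apply: HN.
  exact: leq_trans Nn (leq_addl _ _).
split=> //; rewrite rsE.
have [|||C [C' [C0 C'0 CC' expl]]] := @lojasiewicz_rates R X rr y xbar lam L c p
    lam0 (relaxation_gt0 hL hlam) hc hp _ _ _ y_cvg.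
- by move=> n; exact: (gap_ge0 hg hf hx hargmin).
- move=> n; rewrite /rr /y !addSn addnS.
  exact: (gap_decrease hdot hg hgrad hlip hf hlam hx).
- move=> n; rewrite /rr /y !addSn addnS.
  apply: (gap_lojasiewicz hdot hg hconv hgrad hL hlip hf hlam hx hargmin hc
    hloj).
  set k := (maxn n1 n2 + n)%N; split; rewrite /eball /=.
    apply: lt_le_trans e2delta; rewrite lte_fin distrC; apply: Hn2 => /=.
    by rewrite /k -!addnS (leq_trans (leq_maxr n1 n2))// leq_addr.
  apply: lt_le_trans (leeD2r _ e1r).
  rewrite (objective_iterate hg hf hx) {2}(einf_fin hg hf hargmin).
  rewrite -EFinD lte_fin ltrD2r (le_lt_trans _ Hn1)//.
  apply: (gap_nonincreasing hdot hg hgrad hL hlip hf hlam hx).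
  by rewrite /k -addnS (leq_trans (leq_maxl n1 n2))// leq_addr.
exists C, C'; split=> // /andP[r0 _]; apply: expl; move: r0.
by rewrite lte_fin.
Qed.
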